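(* Let $u$ be analytic on $\mathbb D$ and let $\varphi:\mathbb D\to\mathbb D$ be analytic. Assume that the operator $W_{u,\varphi}$ is bounded on $\mathcal H(b)$. Then, for every $1\leq i\leq n$, either $u^{(\ell)}(\zeta_i)=0$ for all $0\leq \ell\leq m_i-1$, or there exists $\ell$ with $0\leq \ell\leq m_i-1$ such that $u^{(\ell)}(\zeta_i)\neq0$, and then $\varphi$ has a non-tangential limit $\varphi(\zeta_i)$ at $\zeta_i$ that satisfies $\varphi(\zeta_i)\in \mathbb{D}\cup Z(a)$, where $Z(a)=\{\zeta_1,\dots,\zeta_n\}$.
   Context: $\mathbb D$ is the open unit disk, $\mathbb T$ the unit circle; $H^2,H^\infty$ are the Hardy spaces of $\mathbb D$. $b$ is a fixed rational function in the closed unit ball of $H^\infty$ with $\|b\|_\infty=1$ that is not a finite Blaschke product (equivalently, not inner). Its Pythagorean mate $\tilde a$ is the unique outer function with $|\tilde a|^2+|b|^2=1$ a.e. on $\mathbb T$ and $\tilde a(0)>0$; it is rational, without zeros in $\mathbb D$ or poles in $\overline{\mathbb D}$. Its distinct zeros on $\mathbb T$ are $\zeta_1,\dots,\zeta_n$ ($n\ge1$) with multiplicities $m_1,\dots,m_n$; $N=\sum_i m_i$ and $a(z)=\prod_{i=1}^n(z-\zeta_i)^{m_i}$. $\mathcal P_{N-1}$ is the space of polynomials of degree at most $N-1$. The de Branges--Rovnyak space $\mathcal H(b)$ is, as a set, the direct sum $\mathcal H(b)=aH^2\oplus\mathcal P_{N-1}$, equipped with the norm $\|ag+p\|_b^2=\|g\|_2^2+\|p\|_2^2$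 ($g\in H^2$, $p\in\mathcal P_{N-1}$), equivalent to the usual de Branges--Rovnyak norm. For $f\in\mathcal H(b)$, $f$ and its derivatives up to order $m_i-1$ have non-tangential limits at $\zeta_i$, denoted $f^{(k)}(\zeta_i)$. $W_{u,\varphi}f=u\cdot(f\circ\varphi)$; ''bounded on $\mathcal H(b)$'' means that it maps $\mathcal H(b)$ into itself boundedly (in particular $u=W_{u,\varphi}1\in\mathcal H(b)$). *)

(* Defs.v *)
From HB Require Import structures.
From mathcomp Require Import all_boot all_order all_algebra.
From mathcomp Require Import all_classical all_reals all_analysis.
From mathcomp Require Import complex.
Set Implicit Arguments.
Unset Strict Implicit.
Unset Printing Implicit Defensive.
Import Order.TTheory GRing.Theory Num.Theory numFieldNormedType.Exports.
Local Open Scope classical_set_scope.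
Local Open Scope ring_scope.
Local Open Scope complex_scope.

(* R[i] gets the topology and the normed structure over itself of any
   numFieldType; [derivable f z 1] is then complex differentiability at z and
   [derive1n l f] is the l-th complex derivative. *)
#[export, non_forgetful_inheritance]
HB.instance Definition _ (R : realType) := GRing.ComAlgebra.copy R[i] R[i]^o.
#[export, non_forgetful_inheritance]
HB.instance Definition _ (R : realType) := Vector.copy R[i] R[i]^o.
#[export, non_forgetful_inheritance]
HB.instance Definition _ (R : realType) := NormedModule.copy R[i] R[i]^o.

(* The modulus as an element of R; the norm [`|z|] lives in R[i], with
   [`|z| = (cabs z)%:C] by definition. *)
Notation cabs := Normc.normc.

Section Defs.
Variable R : realType.
Implicit Types (f g u phi F : R[i] -> R[i]) (z w zeta : R[i]).

(* Functions on the disk are total functions on R[i] of which only the values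
   on [disk] (and, where stated, on the unit circle) are used. *)
Definition disk : set R[i] := [set z | `|z| < 1].

Definition analytic_disk f : Prop :=
  forall z, disk z -> derivable f z 1.

Definition stolz (M : R) zeta : set R[i] :=
  [set z | disk z /\ `|z - zeta| < M%:C * (1 - `|z|)].

Definition ntlim f zeta w : Prop :=
  forall M : R, 1 < M -> f @ within (stolz M zeta) (nbhs zeta) --> w.

Definition cis (t : R) : R[i] := cos t +i* sin t.

Definition cexp z : R[i] := (expR (complex.Re z))%:C * cis (complex.Im z).

Definition circle_integral (h : R -> R[i]) : R[i] :=
  (\int[lebesgue_measure]_(t in `[0, 2 * pi]) complex.Re (h t)) +i*
  (\int[lebesgue_measure]_(t in `[0, 2 * pi]) complex.Im (h t)).

(* F is determined on the disk, up to a unimodular constant, by the logarithm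
   of the modulus of its boundary values, which are here the values of F on the
   unit circle (as is the case for a rational function without poles there).
   The convention [ln 0 = 0] matters only on a null set. *)
Definition outer F : Prop :=
  (@lebesgue_measure R).-integrable `[0, 2 * pi]
    (EFin \o (fun t => ln (cabs (F (cis t)))))
  /\ exists c, `|c| = 1 /\ forall z, disk z ->
       F z = c * cexp (((2 * pi)^-1)%:C * circle_integral (fun t =>
         (cis t + z) / (cis t - z) * (ln (cabs (F (cis t))))%:C)).

Definition ratfun (p q : {poly R[i]}) : R[i] -> R[i] :=
  fun z => p.[z] / q.[z].

Definition Hinfty_norm f : \bar R :=
  ereal_sup [set (cabs (f z))%:E | z in disk].

(* The empty product is allowed: unimodular constants are finite Blaschke
   products. *)
Definition finite_Blaschke f : Prop :=
  exists (c : R[i]) (s : seq R[i]),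
    [/\ `|c| = 1, (forall x, x \in s -> disk x)
      & forall z, disk z ->
          f z = c * \prod_(x <- s) ((z - x) / (1 - x^* * z))].

Definition pythagorean_mate b F : Prop :=
  [/\ outer F,
      {ae @lebesgue_measure R, forall t : R, t \in `[0, 2 * pi] ->
         cabs (F (cis t)) ^+ 2 + cabs (b (cis t)) ^+ 2 = 1}
    & 0 < F 0].

(* [H2_norm g s]: g belongs to the Hardy space H^2 (it is the sum on the disk of
   a power series with square-summable coefficients) and its norm is s. *)
Definition H2_norm g (s : R) : Prop :=
  exists c : nat -> R[i],
    [/\ (forall z, disk z -> series (fun k => c k * z ^+ k) @ \oo --> g z),
        0 <= s
      & series (fun k => cabs (c k) ^+ 2) @ \oo --> s ^+ 2].

Section deBrangesRovnyak.
Variables (n : nat) (zeta : 'I_n -> R[i]) (m : 'I_n -> nat).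

Definition bdry_poly : {poly R[i]} := \prod_(i < n) ('X - (zeta i)%:P) ^+ m i.

(* [Hb_norm f s]: f belongs to H(b) = a H^2 (+) P_{N-1}, with norm s. *)
Definition Hb_norm f (s : R) : Prop :=
  exists (g : R[i] -> R[i]) (p : {poly R[i]}) (sg sp : R),
    [/\ H2_norm g sg, (size p <= \sum_(i < n) m i)%N /\ H2_norm (horner p) sp,
        (forall z, disk z -> f z = bdry_poly.[z] * g z + p.[z])
      & s = Num.sqrt (sg ^+ 2 + sp ^+ 2)].

Definition wcomp u phi f : R[i] -> R[i] := fun z => u z * f (phi z).

Definition bounded_on_Hb (W : (R[i] -> R[i]) -> R[i] -> R[i]) : Prop :=
  exists M : R, forall f s, Hb_norm f s ->
    exists t, Hb_norm (W f) t /\ t <= M * s.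

End deBrangesRovnyak.
End Defs.

(* Main.v *)
Require Import Defs.
From HB Require Import structures.
From mathcomp Require Import all_boot all_order all_algebra.
From mathcomp Require Import all_classical all_reals all_analysis.
From mathcomp Require Import complex.
From mathcomp Require Import ring lra.
Import Order.TTheory GRing.Theory Num.Theory numFieldNormedType.Exports.
Local Open Scope classical_set_scope.
Local Open Scope ring_scope.
Local Open Scope complex_scope.

(* Fix i and write zeta = zeta_i.  If f = a g + p with g in H^2 and p in
   P_{N-1}, then for l < m_i the nontangential limit of f^(l) at zeta is
   p^(l)(zeta), because (a g)^(l) tends to 0: the Taylor coefficients of g tend
   to 0, so g^(k)(z) = o((1 - |z|)^(-k-1)).  In particular W 1 = u = a g + p;
   suppose that l < m_i is minimal with p^(l)(zeta) <> 0.  For a polynomial f,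
   W f = u (f o phi) = a g_f + p_f, and since f o phi is bounded, p_f vanishes
   to order l at zeta; dividing by (z - zeta)^l, f o phi tends to
   p_f^(l)(zeta) / p^(l)(zeta).  For f = z this is the limit w of phi, and in
   general f(w) = p_f^(l)(zeta) / p^(l)(zeta), so boundedness of W gives
   |f(w)| <= C ||f||_b for all polynomials f.  If |w| = 1 and a(w) <> 0, this
   fails for f = a times a long partial sum of the Cauchy kernel at w. *)

Set Implicit Arguments.
Unset Strict Implicit.
Unset Printing Implicit Defensive.
#[local] Arguments Normc.normc : simpl never.

(** * The modulus on R[i] *)

Lemma cabs_ge0 (R : realType) (z : R[i]) : 0 <= cabs z.
Proof. by case: z => x y; rewrite sqrtr_ge0. Qed.

Lemma cabsM (R : realType) (z w : R[i]) : cabs (z * w) = cabs z * cabs w.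
Proof. exact: Normc.normcM. Qed.

Lemma cabs1 (R : realType) : cabs (1 : R[i]) = 1.
Proof. exact: Normc.normc1. Qed.

Lemma cabs0 (R : realType) : cabs (0 : R[i]) = 0.
Proof. exact: Normc.normc0. Qed.

Lemma cabsV (R : realType) (z : R[i]) : cabs z^-1 = (cabs z)^-1.
Proof. exact: Normc.normcV. Qed.

Lemma cabsX (R : realType) (z : R[i]) n : cabs (z ^+ n) = cabs z ^+ n.
Proof.
by elim: n => [|n IH]; rewrite ?expr0 ?cabs1// !exprS cabsM IH.
Qed.

Lemma cabsN (R : realType) (z : R[i]) : cabs (- z) = cabs z.
Proof. exact: normcN. Qed.

Lemma cabsB (R : realType) (z w : R[i]) : cabs (z - w) = cabs (w - z).
Proof. by rewrite -opprB cabsN. Qed.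

Lemma cabsD_le (R : realType) (z w : R[i]) : cabs (z + w) <= cabs z + cabs w.
Proof. exact: le_normcD. Qed.

Lemma cabs_sum_le (R : realType) (I : Type) (s : seq I) (P : pred I)
    (F : I -> R[i]) :
  cabs (\sum_(i <- s | P i) F i) <= \sum_(i <- s | P i) cabs (F i).
Proof.
elim/big_ind2 : _ => //=; first by rewrite cabs0.
by move=> x a y b xa yb; rewrite (le_trans (cabsD_le _ _))// lerD.
Qed.

Lemma cabs_real (R : realType) (x : R) : cabs x%:C = `|x|.
Proof. by rewrite /Normc.normc/= expr0n/= addr0 sqrtr_sqr. Qed.

Lemma cabs_nat (R : realType) n : cabs (n%:R : R[i]) = n%:R.
Proof. by rewrite -(rmorph_nat (real_complex R)) cabs_real normr_nat. Qed.

Lemma cabs_eq0 (R : realType) (z : R[i]) : (cabs z == 0) = (z == 0).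
Proof.
by apply/eqP/eqP => [/Normc.eq0_normc//|->]; rewrite cabs0.
Qed.

Lemma diskE (R : realType) (z : R[i]) : disk z <-> cabs z < 1.
Proof. by rewrite -ltcR. Qed.

Lemma gt0_complex (R : realType) (e : R[i]) : 0 < e ->
  exists2 d : R, 0 < d & e = d%:C.
Proof.
by case: e => x y; rewrite ltcE/= => /andP[/eqP -> x0]; exists x.
Qed.

(** Passes to real tolerances: a positive element of [R[i]] is a positive real. *)
Lemma cvg_cabsP (R : realType) (T : Type) (F : set_system T)
    {FF : Filter F} (f : T -> R[i]) (y : R[i]) :
  f @ F --> y <->
  (forall e : R, 0 < e -> \forall x \near F, cabs (y - f x) < e).
Proof.
split=> [/cvgrPdist_lt fy e e0|fy].
  have := fy e%:C; rewrite ltcR => /(_ e0).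
  by apply: filterS => x; rewrite ltcR.
apply/cvgrPdist_lt => e /gt0_complex[d d0 ->].
by apply: filterS (fy d d0) => x; rewrite -ltcR.
Qed.

Lemma nbhs_cabsP (R : realType) (z : R[i]) (P : set R[i]) :
  nbhs z P <-> exists2 d : R, 0 < d & forall w, cabs (w - z) < d -> P w.
Proof.
split=> [/nbhs_ballP[e /gt0_complex[d d0 ->] zP]|[d d0 zP]].
  exists d => // w wz; apply: zP; rewrite -ball_normE/= .
  by rewrite -[_ < _]/((cabs (z - w))%:C < d%:C) ltcR cabsB.
apply/nbhs_ballP; exists d%:C; first by rewrite /= ltcR.
move=> w; rewrite -ball_normE/= -[_ < _]/((cabs (z - w))%:C < d%:C) ltcR cabsB.
exact: zP.
Qed.

Lemma cabs_lim_le (R : realType) (T : Type) (F : set_system T)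
    {FF : ProperFilter F} (f : T -> R[i]) (y : R[i]) (B : R) :
  f @ F --> y -> (\forall x \near F, cabs (f x) <= B) -> cabs y <= B.
Proof.
move=> /cvg_cabsP fy fB; apply/ler_addgt0Pr => e e0.
have [x [h1 h2]] := filter_ex (filterI (fy _ e0) fB).
rewrite -[y](subrK (f x)) (le_trans (cabsD_le _ _))// addrC.
by rewrite lerD// ltW.
Qed.

Lemma near_disk (R : realType) (z : R[i]) : disk z -> \forall w \near z, disk w.
Proof.
move/diskE => z1; apply/nbhs_cabsP; exists (1 - cabs z); first by lra.
move=> w wz; apply/diskE; rewrite -[w](subrK z).
by rewrite (le_lt_trans (cabsD_le _ _))//; lra.
Qed.

(** Dividing the quadratic error by [w - z] puts the difference quotient within [B * cabs (w - z)]
    of [d]. Power series satisfy such an error bound term by term. *)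
Lemma is_derive_cabs (R : realType) (f : R[i] -> R[i]) (z d : R[i]) (B e : R) :
  0 < e ->
  (forall w, cabs (w - z) < e ->
     cabs (f w - f z - (w - z) * d) <= B * cabs (w - z) ^+ 2) ->
  is_derive z 1 f d.
Proof.
move=> e0 fB.
(* The bound at the point [z + e/2] forces [B] to be nonnegative. *)
have B0 : 0 <= B.
  have := fB (z + (e / 2)%:C).
  rewrite [_ + _ - z]addrC addKr cabs_real ger0_norm; last by lra.
  have e2 : e / 2 < e by lra.
  move=> /(_ e2) h; have := le_trans (cabs_ge0 _) h.
  by rewrite pmulr_lge0// exprn_gt0//; lra.
have H : h^-1 *: (f (h *: (1 : R[i]) + z) - f z) @[h --> 0^'] --> d.
  apply/cvg_cabsP => eps eps0.
  apply/nbhs_cabsP; exists (Num.min e (eps / (B + 1))).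
    by rewrite lt_min e0 divr_gt0//; lra.
  move=> h; rewrite subr0 lt_min => /andP[he heps] /= h0.
  have hz : h *: (1 : R[i]) + z - z = h by rewrite addrK; exact: mulr1.
  have := fB (h *: (1 : R[i]) + z); rewrite hz => /(_ he).
  set D := f (h *: (1 : R[i]) + z) - f z => hD.
  have -> : d - h^-1 *: D = - (h^-1 * (D - h * d)).
    by rewrite mulrBr mulrA mulVf// mul1r opprB.
  rewrite cabsN cabsM cabsV.
  have h0' : 0 < cabs h by rewrite lt_neqAle eq_sym cabs_eq0 h0 cabs_ge0.
  rewrite mulrC ltr_pdivrMr// (le_lt_trans hD)// expr2 mulrA ltr_pM2r//.
  rewrite (@le_lt_trans _ _ ((B + 1) * cabs h))//.
    by rewrite ler_pM2r//; lra.
  by rewrite mulrC -ltr_pdivlMr//; lra.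
apply: DeriveDef; first by apply/cvg_ex; exists d.
exact: cvg_lim H.
Qed.

(** These are partial sums, with nonnegative terms, of the binomial series of (1 - r)^(-k-1). *)
Lemma bin_geometric_sum (R : realType) (r : R) k M : 0 <= r < 1 ->
  \sum_(n < M) 'C(n + k, k)%:R * r ^+ n <= (1 - r) ^- k.+1.
Proof.
move=> /andP[r0 r1]; have r10 : 0 < 1 - r by lra.
have step0 : (1 - r) * \sum_(n < M) 'C(n + 0, 0)%:R * r ^+ n = 1 - r ^+ M.
  elim: M => [|M IH]; first by rewrite big_ord0 mulr0 expr0 subrr.
  by rewrite big_ord_recr/= mulrDr IH bin0 exprS; ring.
(* By Pascal's rule the factor 1 - r lowers the index of the weight by one, up to subtracting a
   nonnegative term. *)
have step j : (1 - r) * (\sum_(n < M) 'C(n + j.+1, j.+1)%:R * r ^+ n) =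
    \sum_(n < M) 'C(n + j, j)%:R * r ^+ n - 'C(M + j, j.+1)%:R * r ^+ M.
  elim: M {step0} => [|M IH].
    by rewrite !big_ord0 mulr0 add0n bin_small// mul0r subrr.
  rewrite !big_ord_recr/= mulrDr IH addnS addSn !binS !natrD exprS.
  by rewrite ['C(M + j, j.+1)]lock; ring.
elim: k => [|k IH].
  rewrite expr1 -[leRHS]mulr1 ler_pdivlMl// step0.
  by have := exprn_ge0 M r0; lra.
rewrite exprS invfM ler_pdivlMl// step (le_trans _ IH)//.
by rewrite lerBlDr lerDl mulr_ge0// exprn_ge0.
Qed.

(** * Power series on the disk *)

Definition disk_series (R : realType) (c : nat -> R[i]) (f : R[i] -> R[i]) :=
  forall z, disk z -> series (fun n => c n * z ^+ n) @ \oo --> f z.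

(* [c n = o(n ^ k)]: with binomial weights the condition is stable, without
   loss of constants, under termwise differentiation and summation. *)
Definition coef_small (R : realType) (k : nat) (c : nat -> R[i]) :=
  forall e : R, 0 < e ->
    exists n0, forall n, (n0 <= n)%N -> cabs (c n) <= e * 'C(n + k, k)%:R.

Definition deriv_coef (R : realType) (c : nat -> R[i]) : nat -> R[i] :=
  fun n => n.+1%:R * c n.+1.

(** The terms below the threshold [n0] contribute at most the constant [B], whatever [M] and [r]
    are; the others are dominated by [e] times the binomial series. *)
Lemma coef_small_bound (R : realType) k (c : nat -> R[i]) :
  coef_small k c ->
  forall e : R, 0 < e -> exists2 B : R, 0 <= B &
    forall M (r : R), 0 <= r < 1 ->
      \sum_(n < M) cabs (c n) * r ^+ n <= B + e * (1 - r) ^- k.+1.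
Proof.
move=> ck e e0; have [n0 cn0] := ck e e0.
exists (\sum_(n < n0) cabs (c n)).
  by apply: sumr_ge0 => n _; exact: cabs_ge0.
move=> M r r01; have /andP[r0 r1] := r01.
have rn n : 0 <= r ^+ n <= 1.
  by rewrite exprn_ge0//= exprn_ile1// ltW.
have le1 : \sum_(n < M) cabs (c n) * r ^+ n <=
    \sum_(n < M | (n < n0)%N) cabs (c n) +
    \sum_(n < M) e * ('C(n + k, k)%:R * r ^+ n).
  rewrite [X in _ <= X + _]big_mkcond -big_split/=.
  apply: ler_sum => n _; have /andP[rn0 rn1] := rn n; case: ltnP => nn0.
    rewrite -[leLHS]addr0 lerD//.
      by rewrite ler_piMr// cabs_ge0.
    by rewrite mulr_ge0 ?(ltW e0)// mulr_ge0.
  by rewrite add0r mulrA ler_wpM2r// cn0.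
rewrite (le_trans le1)// lerD//.
  (* Both sums are cut at min(M, n0): what remains on the left is empty, what remains on the right
     is nonnegative. *)
  rewrite -(big_mkord xpredT (fun n => cabs (c n))).
  rewrite -(big_mkord (fun n => (n < n0)%N) (fun n => cabs (c n))).
  rewrite (@big_cat_nat _ _ _ (minn M n0) 0 M) ?geq_minl//=.
  rewrite [X in _ + X]big_nat_cond [X in _ + X]big_pred0 ?addr0.
    rewrite (@big_cat_nat _ _ _ (minn M n0) 0 n0) ?geq_minr//= big_mkcond/=.
    rewrite -[leLHS]addr0 lerD ?sumr_ge0//.
    - by apply: ler_sum => n _; case: ifP; rewrite ?cabs_ge0.
    - by move=> n _; exact: cabs_ge0.
  move=> n; rewrite geq_min.
  by case: (leqP M n) => //= Mn; rewrite leqNgt; case: (n < n0)%N.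
rewrite -mulr_sumr ler_wpM2l ?(ltW e0)//; exact: bin_geometric_sum.
Qed.

(** Since (n+1) C(n+1+k, k) = (k+1) C(n+k+1, k+1), the tolerance e/(k+1) for [c] gives [e] for the
    derived coefficients. *)
Lemma coef_small_deriv (R : realType) k (c : nat -> R[i]) :
  coef_small k c -> coef_small k.+1 (deriv_coef c).
Proof.
move=> ck e e0; have k0 : (0 : R) < k.+1%:R by rewrite ltr0n.
have [n0 cn0] := ck _ (divr_gt0 e0 k0).
exists n0 => n n0n; rewrite /deriv_coef cabsM cabs_nat.
have := cn0 n.+1 (leqW n0n).
rewrite -(@ler_pM2l _ n.+1%:R) ?ltr0n// => /le_trans; apply.
have -> : 'C(n + k.+1, k.+1)%:R = n.+1%:R * 'C(n.+1 + k, k)%:R / k.+1%:R :> R.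
  apply: (canRL (mulfK (lt0r_neq0 k0))); rewrite -!natrM; congr (_%:R).
  by rewrite mulnC addnS -addSn mul_bin_left addnK mulnC.
by rewrite le_eqVlt; apply/orP; left; apply/eqP; ring.
Qed.

Lemma cabs_Re_Im (R : realType) (z : R[i]) :
  [/\ `|complex.Re z| <= cabs z, `|complex.Im z| <= cabs z &
      cabs z <= `|complex.Re z| + `|complex.Im z|].
Proof.
have h (x y : R) : `|x| <= Num.sqrt (x ^+ 2 + y ^+ 2).
  by rewrite -sqrtr_sqr ler_sqrt ?addr_ge0 ?sqr_ge0// lerDl sqr_ge0.
case: z => x y; rewrite /Normc.normc/=; split=> //; first by rewrite addrC.
rewrite -[leRHS]ger0_norm ?addr_ge0// -sqrtr_sqr ler_sqrt ?sqr_ge0//.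
rewrite sqrrD !real_normK ?num_real// -addrA [X in _ <= _ + X]addrC addrA.
by rewrite lerDl mulrn_wge0// mulr_ge0.
Qed.

(** Real and imaginary parts are dominated by the modulus, so both are absolutely convergent real
    series. *)
Lemma cvg_series_cabs (R : realType) (a : nat -> R[i]) (B : R) :
  (forall M, \sum_(n < M) cabs (a n) <= B) -> cvgn (series a).
Proof.
move=> aB.
have cvgR (x : nat -> R) : (forall n, `|x n| <= cabs (a n)) -> cvgn (series x).
  move=> xa; apply: normed_cvg; apply: nondecreasing_is_cvgn.
    by apply: nondecreasing_series => n _ _; exact: normr_ge0.
  exists B => _ [M _ <-]; apply: le_trans (aB M).
  rewrite /= /series/= big_mkord.
  exact: ler_sum.
have /cvg_ex[/= x xP] := cvgR (fun n => complex.Re (a n))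
  (fun n => let: And3 h _ _ := cabs_Re_Im (a n) in h).
have /cvg_ex[/= y yP] := cvgR (fun n => complex.Im (a n))
  (fun n => let: And3 _ h _ := cabs_Re_Im (a n) in h).
apply/cvg_ex; exists (x +i* y); apply/cvg_cabsP => e e0.
have e2 : 0 < e / 2 by lra.
have /cvgrPdist_lt/(_ _ e2) hx := xP.
have /cvgrPdist_lt/(_ _ e2) hy := yP.
apply: filterS (filterI hx hy) => n [hxn hyn].
have [_ _ h] := cabs_Re_Im (x +i* y - series a n).
rewrite (le_lt_trans h)//.
have -> : series a n = series (fun n => complex.Re (a n)) n +i*
                       series (fun n => complex.Im (a n)) n.
  rewrite /series/=; elim: n {hxn hyn h} => [|n IH].
    by rewrite !big_geq.
  by rewrite !big_nat_recr//= IH; case: (a n).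
rewrite /=; lra.
Qed.

Lemma coef_small_cvg (R : realType) k (c : nat -> R[i]) z :
  coef_small k c -> disk z -> cvgn (series (fun n => c n * z ^+ n)).
Proof.
move=> /coef_small_bound/(_ 1 ltr01)[B B0 cB] /diskE z1.
apply: (@cvg_series_cabs _ _ (B + 1 * (1 - cabs z) ^- k.+1)) => M.
rewrite (le_trans _ (cB M (cabs z) _))// ?cabs_ge0//.
by apply: ler_sum => n _; rewrite cabsM cabsX.
Qed.

(** By induction: the next error is w times the present one plus (n+2) z^(n+1) (w - z)^2, and the
    binomial constants add up by Pascal's rule. *)
Lemma second_difference_bound (R : realType) (z w : R[i]) (rho : R) n :
  cabs z <= rho -> cabs w <= rho ->
  cabs (w ^+ n.+2 - z ^+ n.+2 - (w - z) * (n.+2%:R * z ^+ n.+1)) <=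
  'C(n.+2, 2)%:R * rho ^+ n * cabs (w - z) ^+ 2.
Proof.
move=> zr wr; have r0 : 0 <= rho := le_trans (cabs_ge0 _) zr.
elim: n => [|n IH].
  rewrite binn expr0 !mul1r -cabsX le_eqVlt; apply/orP; left; apply/eqP.
  by congr (cabs _); ring.
set A := (X in cabs X <= _) in IH.
have -> : w ^+ n.+3 - z ^+ n.+3 - (w - z) * (n.+3%:R * z ^+ n.+2) =
    w * A + n.+2%:R * z ^+ n.+1 * (w - z) ^+ 2.
  by rewrite /A !exprS -(natr1 n.+2); ring.
rewrite (le_trans (cabsD_le _ _))// !cabsM !cabsX cabs_nat.
have -> : 'C(n.+3, 2)%:R = 'C(n.+2, 2)%:R + n.+2%:R :> R.
  by rewrite binS bin1 natrD.
rewrite [X in _ <= X * _]mulrDl [leRHS]mulrDl lerD//.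
  by rewrite exprS [_ * (rho * _)]mulrCA -mulrA ler_pM ?cabs_ge0.
by rewrite ler_wpM2r ?sqr_ge0// ler_wpM2l// lerXn2r// nnegrE cabs_ge0.
Qed.

(** Termwise second differences are summed; the twice differentiated series, taken with absolute
    values at a radius [rho] < 1, bounds the total. *)
Lemma disk_series_is_derive (R : realType) k (c : nat -> R[i]) f z :
  coef_small k c -> disk_series c f -> disk z ->
  is_derive z 1 f (limn (series (fun n => deriv_coef c n * z ^+ n))).
Proof.
move=> ck cf dz; have /diskE z1 := dz.
set d := limn _.
have cd : series (fun n => deriv_coef c n * z ^+ n) @ \oo --> d.
  exact: (coef_small_cvg (coef_small_deriv ck) dz).
have [B _ cB] :=
  coef_small_bound (coef_small_deriv (coef_small_deriv ck)) (@ltr01 R).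
(* Midway between |z| and 1, so that the disk of radius (1 - |z|)/2 about z stays within modulus
   [rho]. *)
pose rho := (1 + cabs z) / 2.
have z0 := cabs_ge0 z.
have r01 : 0 <= rho < 1 by rewrite /rho; lra.
have zrho : cabs z <= rho by rewrite /rho; lra.
have e0 : 0 < (1 - cabs z) / 2 by lra.
apply: (@is_derive_cabs _ _ _ _ (B + 1 * (1 - rho) ^- k.+3) _ e0) => w wz.
have wrho : cabs w <= rho.
  by rewrite -[w](subrK z) (le_trans (cabsD_le _ _))// /rho; lra.
have dw : disk w by apply/diskE; rewrite (le_lt_trans wrho)//; case/andP: r01.
(* Partial sums for the error of the linear approximation. The offsets 2 and 1 align the degrees:
   degrees 0 and 1 cancel and only second differences remain. *)
pose D (M : nat) : R[i] := series (fun n => c n * w ^+ n) M.+2 -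
  series (fun n => c n * z ^+ n) M.+2 -
  (w - z) * series (fun n => deriv_coef c n * z ^+ n) M.+1.
have Dcvg : D @ \oo --> f w - f z - (w - z) * d.
  apply: cvgB; first apply: cvgB.
  - by have := cf _ dw; rewrite -(cvg_shiftn 2); under eq_fun do rewrite addn2.
  - by have := cf _ dz; rewrite -(cvg_shiftn 2); under eq_fun do rewrite addn2.
  - apply: cvgM; first exact: cvg_cst.
    by have := cd; rewrite -(cvg_shiftn 1); under eq_fun do rewrite addn1.
apply: (cabs_lim_le Dcvg); apply: nearW => M.
have -> : D M = \sum_(n < M)
    c n.+2 * (w ^+ n.+2 - z ^+ n.+2 - (w - z) * (n.+2%:R * z ^+ n.+1)).
  rewrite /D /series/=; elim: M => [|M IH].
    rewrite big_ord0 !big_nat_recr//= !big_geq// /deriv_coef !expr0 !expr1.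
    by ring.
  rewrite big_ord_recr/= -IH.
  rewrite [\sum_(0 <= i < M.+3) (c i * w ^+ i)]big_nat_recr//=.
  rewrite [\sum_(0 <= i < M.+3) (c i * z ^+ i)]big_nat_recr//=.
  rewrite [\sum_(0 <= i < M.+2) (deriv_coef c i * z ^+ i)]big_nat_recr//=.
  by rewrite /deriv_coef; ring.
rewrite (le_trans (cabs_sum_le _ _ _))//.
rewrite (le_trans _ (ler_wpM2r (sqr_ge0 _) (cB M rho r01)))//.
rewrite mulr_suml; apply: ler_sum => n _.
rewrite cabsM /deriv_coef !cabsM !cabs_nat.
have D2 := second_difference_bound n zrho wrho.
rewrite (le_trans (ler_wpM2l (cabs_ge0 _) D2))//.
rewrite [leLHS]mulrA; apply: ler_wpM2r; first exact: sqr_ge0.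
rewrite [leLHS]mulrA; apply: ler_wpM2r.
  by rewrite exprn_ge0// (le_trans _ zrho).
rewrite [leRHS]mulrA [leLHS]mulrC; apply: ler_wpM2r; first exact: cabs_ge0.
(* C(n+2, 2) is at most (n+1)(n+2) = 2 C(n+2, 2). *)
rewrite -natrM ler_nat.
by have := mul_bin_diag n.+2 1; rewrite bin1 mulnC => ->; rewrite leq_pmull.
Qed.

Lemma disk_series_deriv (R : realType) k (c : nat -> R[i]) f :
  coef_small k c -> disk_series c f -> disk_series (deriv_coef c) (derive1 f).
Proof.
move=> ck cf z dz; rewrite derive1E.
have [_ ->] := disk_series_is_derive ck cf dz.
exact: (coef_small_cvg (coef_small_deriv ck) dz).
Qed.

Lemma disk_series_at0 (R : realType) (c : nat -> R[i]) f :
  disk_series c f -> f 0 = c 0%N.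
Proof.
move=> cf; have d0 : disk (0 : R[i]) by apply/diskE; rewrite cabs0 ltr01.
rewrite -(cvg_lim (@norm_hausdorff _ _) (cf _ d0)).
apply: cvg_lim; first exact: norm_hausdorff.
rewrite -(cvg_shiftn 1) (_ : (fun n => _) = cst (c 0%N)); first exact: cvg_cst.
apply/funext => n; rewrite addn1 /series/= big_nat_recl// expr0 mulr1.
rewrite big1 ?addr0// => i _.
by rewrite expr0n mulr0.
Qed.

(** Compare values at 0, then differentiate and repeat. This identifies the unspecified coefficients
    behind [H2_norm] with those of a given polynomial. *)
Lemma disk_series_unique (R : realType) k (c c' : nat -> R[i]) f f' :
  coef_small k c -> coef_small k c' -> disk_series c f -> disk_series c' f' ->
  (forall z, disk z -> f z = f' z) -> c =1 c'.
Proof.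
move=> ck ck' cf cf' ff' n.
have eqf (g g' : R[i] -> R[i]) : (forall z, disk z -> g z = g' z) ->
    forall z, disk z -> derive1 g z = derive1 g' z.
  move=> gg' z dz; rewrite !derive1E; apply: near_eq_derive.
  by apply: filterS (near_disk dz) => w; exact: gg'.
elim: n k c c' f f' ck ck' cf cf' ff' => [|n IH] k c c' f f' ck ck' cf cf' ff'.
  rewrite -(disk_series_at0 cf) -(disk_series_at0 cf'); apply: ff'.
  by apply/diskE; rewrite cabs0 ltr01.
have := IH _ _ _ _ _ (coef_small_deriv ck) (coef_small_deriv ck')
  (disk_series_deriv ck cf) (disk_series_deriv ck' cf') (eqf _ _ ff').
by rewrite /deriv_coef => /mulfI; apply; rewrite pnatr_eq0.
Qed.

(** The growth is o((1 - |z|)^(-k-1)): half of [e] pays for the tail of the series, and the other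
    half for the constant [B], which is multiplied by at most 1 - |z|. *)
Lemma disk_series_boundary_bound (R : realType) k (c : nat -> R[i]) f :
  coef_small k c -> disk_series c f -> forall e : R, 0 < e ->
  exists2 d : R, 0 < d & forall z, disk z -> 1 - cabs z < d ->
    (1 - cabs z) ^+ k.+1 * cabs (f z) < e.
Proof.
move=> ck cf e e0; have e2 : 0 < e / 2 by lra.
have [B B0 cB] := coef_small_bound ck e2.
exists (Num.min 1 (e / (2 * (B + 1)))).
  by rewrite lt_min ltr01 divr_gt0//; lra.
move=> z dz; rewrite lt_min => /andP[h1 h2].
have /diskE z1 := dz; have z0 := cabs_ge0 z.
have x0 : 0 < 1 - cabs z by lra.
have fB : cabs (f z) <= B + e / 2 * (1 - cabs z) ^- k.+1.
  apply: (cabs_lim_le (cf z dz)); apply: nearW => M.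
  rewrite /series/= big_mkord (le_trans (cabs_sum_le _ _ _))//.
  rewrite (le_trans _ (cB M (cabs z) _)) ?z0//.
  by apply: ler_sum => n _; rewrite cabsM cabsX.
rewrite (le_lt_trans (ler_wpM2l (exprn_ge0 _ (ltW x0)) fB))//.
rewrite mulrDr [_ * (e / 2 * _)]mulrC mulfVK ?expf_neq0 ?lt0r_neq0//.
have : (1 - cabs z) ^+ k.+1 <= 1 - cabs z.
  by rewrite exprS ler_piMr ?(ltW x0)// exprn_ile1 ?(ltW x0)//; lra.
move=> /(ler_wpM2r B0).
move: h2; rewrite ltr_pdivlMr; last by lra.
by nra.
Qed.

(** * Coefficients of H^2 functions and of polynomials *)

Lemma H2_norm_series (R : realType) g (s : R) :
  H2_norm g s -> exists c : nat -> R[i],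
    [/\ disk_series c g, coef_small 0 c & forall k, cabs (c k) <= s].
Proof.
move=> [c [cg s0 cs]]; exists c; split=> // [e e0|k].
  (* The terms of a convergent series tend to 0, and the weight C(n, 0) is 1. *)
  have /cvgrPdist_lt/(_ (e ^+ 2) (exprn_gt0 _ e0)) [n0 _ h] :=
    cvg_series_cvg_0 (cvgP _ cs).
  exists n0 => n /h; rewrite sub0r normrN bin0 mulr1.
  rewrite ger0_norm ?sqr_ge0// => /ltW.
  by rewrite ler_sqr ?nnegrE ?cabs_ge0 ?(ltW e0).
have c2 n : 0 <= cabs (c n) ^+ 2 by rewrite sqr_ge0.
have /nondecreasing_cvgn_le/(_ (cvgP _ cs) k.+1) :
    nondecreasing_seq (series (fun k => cabs (c k) ^+ 2)).
  by apply: nondecreasing_series => n _ _; exact: c2.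
rewrite (cvg_lim _ cs)// /series/= big_nat_recr//= => h.
rewrite -ler_sqr ?nnegrE ?cabs_ge0// (le_trans _ h)// lerDr.
by apply: sumr_ge0.
Qed.

Lemma poly_disk_series (R : realType) (p : {poly R[i]}) :
  disk_series (fun n => p`_n) (horner p) /\ coef_small 0 (fun n => p`_n).
Proof.
split=> [z _|e e0].
  rewrite -(cvg_shiftn (size p)) (_ : (fun n => _) = cst p.[z]).
    exact: cvg_cst.
  apply/funext => n; rewrite horner_coef.
  rewrite -(big_mkord xpredT (fun i => p`_i * z ^+ i)).
  rewrite /series/= (@big_cat_nat _ _ _ (size p))//= ?leq_addl//.
  rewrite [X in _ + X]big_nat_cond [X in _ + X]big1 ?addr0// => i.
  by rewrite andbT => /andP[pi _]; rewrite nth_default// mul0r.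
exists (size p) => n pn; rewrite nth_default// cabs0.
by rewrite mulr_ge0// ltW.
Qed.

Lemma poly_H2_norm (R : realType) (p : {poly R[i]}) :
  H2_norm (horner p) (Num.sqrt (\sum_(i < size p) cabs p`_i ^+ 2)).
Proof.
exists (fun n => p`_n); split; first by case: (poly_disk_series p).
  exact: sqrtr_ge0.
rewrite sqr_sqrtr; last by apply: sumr_ge0 => i _; exact: sqr_ge0.
rewrite -(cvg_shiftn (size p)) (_ : (fun n => _) =
  cst (\sum_(i < size p) cabs p`_i ^+ 2)); first exact: cvg_cst.
apply/funext => n; rewrite -(big_mkord xpredT (fun i => cabs p`_i ^+ 2)).
rewrite /series/= (@big_cat_nat _ _ _ (size p))//= ?leq_addl//.
rewrite [X in _ + X]big_nat_cond [X in _ + X]big1 ?addr0// => i.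
by rewrite andbT => /andP[pi _]; rewrite nth_default// cabs0 expr0n.
Qed.

Lemma H2_norm_coef_le (R : realType) (p : {poly R[i]}) (s : R) k :
  H2_norm (horner p) s -> cabs p`_k <= s.
Proof.
move=> /H2_norm_series[c [cp c0 cs]]; have [pp p0] := poly_disk_series p.
by rewrite (disk_series_unique p0 c0 pp cp (fun _ _ => erefl) k).
Qed.

(** Each coefficient is at most the H^2 norm, so the values of [L] at the monomials of degree below
    [N] give the constant. It is applied to the l-th derivative at zeta. *)
Lemma poly_linear_functional_bound (R : realType) N
    (L : {linear {poly R[i]} -> R[i] | *%R}) :
  exists2 C : R, 0 <= C & forall (p : {poly R[i]}) (s : R),
    (size p <= N)%N -> H2_norm (horner p) s -> cabs (L p) <= C * s.
Proof.
exists (\sum_(k < N) cabs (L 'X^k)).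
  by apply: sumr_ge0 => *; exact: cabs_ge0.
move=> p s pN ps.
have -> : p = \sum_(k < N) p`_k *: 'X^k.
  rewrite -[p in LHS]coefK poly_def (big_ord_widen N (fun k => p`_k *: 'X^k))//.
  rewrite big_mkcond/=; apply: eq_bigr => k _; case: ltnP => // pk.
  by rewrite nth_default// scale0r.
rewrite linear_sum/= mulr_suml (le_trans (cabs_sum_le _ _ _))//.
apply: ler_sum => k _; rewrite linearZ/= cabsM mulrC ler_wpM2l ?cabs_ge0//.
exact: H2_norm_coef_le ps.
Qed.

Lemma poly_bounded_disk (R : realType) (p : {poly R[i]}) :
  exists2 B : R, 0 <= B & forall z, disk z -> cabs p.[z] <= B.
Proof.
exists (\sum_(i < size p) cabs p`_i).
  by apply: sumr_ge0 => *; exact: cabs_ge0.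
move=> z /diskE z1; rewrite horner_coef (le_trans (cabs_sum_le _ _ _))//.
apply: ler_sum => i _; rewrite cabsM cabsX ler_piMr ?cabs_ge0//.
by rewrite exprn_ile1 ?cabs_ge0// ltW.
Qed.

(** * Higher derivatives of h g + p *)

Lemma is_derive_horner (R : realType) (p : {poly R[i]}) (z : R[i]) :
  is_derive z 1 (horner p) p^`().[z].
Proof.
elim/poly_ind: p => [|p c IH].
  rewrite deriv0 horner0 (_ : horner 0 = cst 0); first exact: is_derive_cst.
  by apply/funext => w; rewrite horner0.
have -> : horner (p * 'X + c%:P) = horner p * id + cst c.
  by apply/funext => w; rewrite hornerMXaddC.
apply: is_derive_eq.
rewrite derivMXaddC hornerD hornerMX addr0.
by rewrite -[p.[z] *: _]/(p.[z] * 1) mulr1 -[id z *: _]/(z * _) mulrC.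
Qed.

Lemma derive1n_eq_disk (R : realType) (f g : R[i] -> R[i]) l :
  (forall z, disk z -> f z = g z) ->
  forall z, disk z -> derive1n l f z = derive1n l g z.
Proof.
move=> fg; elim: l => [//|l IH] z dz; rewrite !derive1nS !derive1E.
by apply: near_eq_derive; apply: filterS (near_disk dz) => w /IH.
Qed.

Lemma disk_series_derive1n (R : realType) (c : nat -> R[i]) g k :
  coef_small 0 c -> disk_series c g ->
  exists2 c', coef_small k c' & disk_series c' (derive1n k g).
Proof.
move=> c0 cg; elim: k => [|k [c' c'k c'g]]; first by exists c.
exists (deriv_coef c'); first exact: coef_small_deriv.
by rewrite derive1nS; exact: disk_series_deriv c'k c'g.
Qed.

Lemma dvdp_deriv_XsubC (F : fieldType) (zeta : F) n (p : {poly F}) :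
  ('X - zeta%:P) ^+ n %| p -> ('X - zeta%:P) ^+ n.-1 %| p^`().
Proof.
case: n => [|n] /dvdpP[q ->]; first by rewrite expr0 dvd1p.
rewrite derivM deriv_exp derivXsubC mul1r/= dvdp_add//.
  by rewrite exprS mulrA dvdp_mull.
by rewrite mulrnAr -mulrnAl dvdp_mull.
Qed.

(* Leibniz' rule, keeping only the order of vanishing of the polynomial
   coefficients at zeta. *)
Lemma derive1n_mul_poly (R : realType) (zeta : R[i]) (m : nat)
    (h p : {poly R[i]}) (c : nat -> R[i]) g l :
  coef_small 0 c -> disk_series c g -> (l <= m)%N ->
  ('X - zeta%:P) ^+ m %| h ->
  exists2 Q : nat -> {poly R[i]},
    forall k, ('X - zeta%:P) ^+ (m - l + k) %| Q k &
    forall z, disk z -> derive1n l (fun z => h.[z] * g z + p.[z]) z =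
      \sum_(k < l.+1) (Q k).[z] * derive1n k g z + p^`(l).[z].
Proof.
move=> c0 cg; elim: l => [|l IH] lm hm.
  exists (fun k => if k is 0%N then h else 0) => [[|k]|z _].
  - by rewrite subn0 addn0.
  - by rewrite dvdp0.
  - by rewrite big_ord_recl big_ord0 addr0 derivn0.
have [Q Qdvd Qeq] := IH (ltnW lm) hm.
(* Product rule: the term of index k comes from differentiating [Q k] and from differentiating g in
   the term of index k - 1. The test on k discards [Q l.+1], which is absent from the sum at stage
   l. *)
exists (fun k => (if (k <= l)%N then (Q k)^`() else 0) +
                 (if k is k'.+1 then Q k' else 0)) => [k|z dz].
  have mlS : (m - l = (m - l.+1).+1)%N by rewrite subnSK.
  apply: dvdp_add.
    case: ifP => _; last exact: dvdp0.
    by have := dvdp_deriv_XsubC (Qdvd k); rewrite mlS.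
  case: k => [|k]; first exact: dvdp0.
  by rewrite addnS -addSn -mlS.
rewrite derive1nS derive1E.
transitivity ('D_1 (\sum_(k < l.+1) (horner (Q k) * derive1n k g) +
  horner p^`(l)) z).
  apply: near_eq_derive; apply: filterS (near_disk dz) => w dw.
  by rewrite (Qeq w dw)/= fctE fct_sumE.
have Dg k : is_derive z 1 (derive1n k g) (derive1n k.+1 g z).
  have [c' c'k c'g] := disk_series_derive1n k c0 cg.
  have D := disk_series_is_derive c'k c'g dz.
  by rewrite derive1nS derive1E; case: D => D1 D2; apply: DeriveDef.
have DM k : is_derive z 1 (horner (Q k) * derive1n k g)
    ((Q k).[z] * derive1n k.+1 g z + derive1n k g z * (Q k)^`().[z]).
  exact: (is_deriveM (is_derive_horner (Q k) z) (Dg k)).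
have Dsum := @is_derive_sum _ _ _ l.+1 _ z 1 _ (fun k : 'I_l.+1 => DM k).
have [_ ->] := is_deriveD Dsum (is_derive_horner p^`(l) z).
rewrite -derivnS; congr (_ + _).
rewrite big_split/=.
under [RHS]eq_bigr do rewrite hornerD mulrDl.
rewrite [RHS]big_split/= addrC; congr (_ + _).
  rewrite [RHS]big_ord_recr/= ltnn horner0 mul0r addr0.
  by apply: eq_bigr => k _; rewrite -ltnS ltn_ord mulrC.
by rewrite [RHS]big_ord_recl/= horner0 mul0r add0r.
Qed.

(** * Nontangential limits *)

Notation ntfilter M zeta := (within (stolz M zeta) (nbhs zeta)).

Lemma stolzE (R : realType) (M : R) (zeta z : R[i]) :
  stolz M zeta z <-> disk z /\ cabs (z - zeta) < M * (1 - cabs z).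
Proof.
rewrite /stolz/=.
have -> : M%:C * (1 - `|z|) = (M * (1 - cabs z))%:C.
  by rewrite rmorphM rmorphB rmorph1.
by rewrite -ltcR.
Qed.

(** The radial points (1 - r) zeta lie in the Stolz region because [M] > 1, so limits along it are
    unique. *)
Lemma ntfilter_proper (R : realType) (M : R) (zeta : R[i]) :
  1 < M -> cabs zeta = 1 -> ProperFilter (ntfilter M zeta).
Proof.
move=> M1 zeta1; apply: Build_ProperFilter_ex => P /nbhs_cabsP[d d0 dP].
pose r := Num.min (d / 2) (1 / 2).
have [r0 r1 rd] : [/\ 0 < r, r < 1 & r < d].
  rewrite lt_min !gt_min; split;
    [apply/andP; split|apply/orP; right|apply/orP; left]; lra.
have E : cabs ((1 - r)%:C * zeta - zeta) = r.
  have -> : (1 - r)%:C * zeta - zeta = (- r)%:C * zeta.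
    by rewrite rmorphN rmorphB rmorph1; ring.
  by rewrite cabsM zeta1 mulr1 cabs_real normrN gtr0_norm.
have E2 : cabs ((1 - r)%:C * zeta) = 1 - r.
  by rewrite cabsM zeta1 mulr1 cabs_real gtr0_norm//; lra.
exists ((1 - r)%:C * zeta); apply: dP; first by rewrite E.
apply/stolzE; rewrite diskE E E2; split; first by lra.
by rewrite opprB addrC subrK; nra.
Qed.

Lemma ntfilter_disk (R : realType) (M : R) (zeta : R[i]) :
  \forall z \near ntfilter M zeta, disk z.
Proof. by rewrite near_withinE; apply: nearW => z /stolzE[]. Qed.

Lemma cvg_near_eq (R : realType) (T : Type) (F : set_system T)
    {FF : Filter F} (f g : T -> R[i]) (w : R[i]) :
  f @ F --> w -> (\forall x \near F, f x = g x) -> g @ F --> w.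
Proof. by move=> fw fg; apply: cvg_trans fw; exact: near_eq_cvg. Qed.

Lemma ntlim_eq_disk (R : realType) (f g : R[i] -> R[i]) zeta w :
  (forall z, disk z -> f z = g z) -> ntlim f zeta w -> ntlim g zeta w.
Proof.
move=> fg fw M M1; apply: cvg_near_eq (fw M M1) _.
by apply: filterS (ntfilter_disk M zeta) => z /fg ->.
Qed.

Lemma cvg_horner (R : realType) (T : Type) (F : set_system T) {FF : Filter F}
    (f : T -> R[i]) w (p : {poly R[i]}) :
  f @ F --> w -> (fun x => p.[f x]) @ F --> p.[w].
Proof.
move=> fw; elim/poly_ind: p => [|p c IH].
  by rewrite (_ : (fun x => _) = cst 0) ?horner0; [exact: cvg_cst|
     apply/funext => x; rewrite horner0].
rewrite hornerMXaddC (_ : (fun x => _) = (fun x => p.[f x] * f x + c)).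
  by have := cvgD (cvgM IH fw) (@cvg_cst _ c _ F _); apply.
by apply/funext => x; rewrite hornerMXaddC.
Qed.

Lemma ntlim_horner (R : realType) (zeta : R[i]) (p : {poly R[i]}) :
  ntlim (horner p) zeta p.[zeta].
Proof. by move=> M M1; apply: cvg_horner; exact: cvg_within. Qed.

(* In a Stolz region [|z - zeta|] is comparable to [1 - |z|], so a zero of order
   k + 1 beats the growth of the k-th derivative of an H^2 function. *)
Lemma ntlim_vanishing (R : realType) (zeta : R[i]) k (Q : {poly R[i]})
    (c : nat -> R[i]) g :
  cabs zeta = 1 -> coef_small k c -> disk_series c g ->
  ('X - zeta%:P) ^+ k.+1 %| Q ->
  ntlim (fun z => Q.[z] * g z) zeta 0.
Proof.
move=> zeta1 ck cg /dvdpP[q ->] M M1.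
have [B B0 qB] := poly_bounded_disk q.
have M0 : 0 < M by lra.
apply/cvg_cabsP => e e0.
have Mk : 0 < (B + 1) * M ^+ k.+1 by rewrite mulr_gt0 ?exprn_gt0//; lra.
have [d d0 hd] := disk_series_boundary_bound ck cg (divr_gt0 e0 Mk).
apply/nbhs_cabsP; exists d => // z zd /stolzE[dz zM]; have /diskE z1 := dz.
rewrite sub0r cabsN.
(* Triangle inequality with |zeta| = 1. *)
have z1d : 1 - cabs z < d.
  rewrite (le_lt_trans _ zd)// lerBlDr -zeta1 -{1}[zeta](subrK z).
  by rewrite (le_trans (cabsD_le _ _))// lerD2r cabsB.
have := hd z dz z1d; rewrite ltr_pdivlMr//; apply: le_lt_trans.
rewrite hornerM horner_exp hornerXsubC !cabsM cabsX.
have x0 : 0 < 1 - cabs z by lra.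
have -> : (1 - cabs z) ^+ k.+1 * cabs (g z) * ((B + 1) * M ^+ k.+1) =
    (B + 1) * (M * (1 - cabs z)) ^+ k.+1 * cabs (g z) by rewrite exprMn; ring.
rewrite ler_wpM2r ?cabs_ge0// ler_pM ?exprn_ge0 ?cabs_ge0//.
  by rewrite (le_trans (qB z dz))//; lra.
rewrite lerXn2r ?nnegrE ?cabs_ge0 ?(ltW zM)//.
by rewrite mulr_ge0// ltW.
Qed.

Lemma ntlim_sum (R : realType) (I : Type) (s : seq I) (f : I -> R[i] -> R[i])
    (zeta : R[i]) (w : I -> R[i]) :
  (forall i, ntlim (f i) zeta (w i)) ->
  ntlim (fun z => \sum_(i <- s) f i z) zeta (\sum_(i <- s) w i).
Proof.
move=> fw M M1; elim: s => [|i s IH].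
  rewrite big_nil (_ : (fun z => _) = cst 0); first exact: cvg_cst.
  by apply/funext => z; rewrite big_nil.
rewrite big_cons (_ : (fun z => _) = (fun z => f i z + \sum_(j <- s) f j z)).
  by have := cvgD (fw i M M1) IH; apply.
by apply/funext => z; rewrite big_cons.
Qed.

(** In Leibniz' formula the factor of g^(k) vanishes at zeta to order m - l + k, which is at least k
    + 1 as l < m; only p^(l) survives. *)
Lemma ntlim_derive1n (R : realType) (zeta : R[i]) m (h p : {poly R[i]})
    (s : R) (f g : R[i] -> R[i]) l :
  cabs zeta = 1 -> H2_norm g s -> (l < m)%N -> ('X - zeta%:P) ^+ m %| h ->
  (forall z, disk z -> f z = h.[z] * g z + p.[z]) ->
  ntlim (derive1n l f) zeta p^`(l).[zeta].
Proof.
move=> zeta1 /H2_norm_series[c [cg c0 _]] lm hm fE.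
have [Q Qdvd Qeq] := derive1n_mul_poly p c0 cg (ltnW lm) hm.
have -> : p^`(l).[zeta] = \sum_(k < l.+1) 0 + p^`(l).[zeta].
  by rewrite big1_eq add0r.
apply: (@ntlim_eq_disk _ (fun z =>
  \sum_(k < l.+1) (Q k).[z] * derive1n k g z + p^`(l).[z])) => [z dz|M M1].
  by rewrite (derive1n_eq_disk l fE dz) Qeq.
have Qlim : ntlim (fun z => \sum_(k < l.+1) (Q k).[z] * derive1n k g z) zeta
    (\sum_(k < l.+1) 0).
  apply: ntlim_sum => k; have [c' c'k c'g] := disk_series_derive1n k c0 cg.
  apply: (ntlim_vanishing zeta1 c'k c'g); apply: dvdp_trans (Qdvd k).
  by rewrite dvdp_exp2l// -add1n leq_add2r subn_gt0.
have := cvgD (Qlim M M1) (@ntlim_horner _ zeta p^`(l) M M1); apply.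
Qed.

(** * Boundary limits of f o phi for polynomials f *)

Lemma cvg_mul_bounded (R : realType) (T : Type) (F : set_system T)
    {FF : Filter F} (f g : T -> R[i]) (B : R) :
  f @ F --> (0 : R[i]) -> (\forall x \near F, cabs (g x) <= B) ->
  (fun x => f x * g x) @ F --> (0 : R[i]).
Proof.
move=> /cvg_cabsP f0 gB; apply/cvg_cabsP => e e0.
have B0 : 0 < `|B| + 1 by rewrite ltr_wpDl.
apply: filterS (filterI (f0 _ (divr_gt0 e0 B0)) gB) => x [].
rewrite !sub0r !cabsN cabsM ltr_pdivlMr// => fx gx.
rewrite (le_lt_trans _ fx)// ler_wpM2l ?cabs_ge0// (le_trans gx)//.
by rewrite (le_trans (ler_norm _))// lerDl.
Qed.

(** The derivative of q (X - zeta)^(l+1) is (q' (X - zeta) + (l+1) q) (X - zeta)^l, and the first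
    summand of the new cofactor vanishes at zeta. *)
Lemma derivn_XsubC_mul (F : fieldType) (zeta : F) l (q : {poly F}) :
  (q * ('X - zeta%:P) ^+ l)^`(l).[zeta] = l`!%:R * q.[zeta].
Proof.
elim: l q => [|l IH] q; first by rewrite expr0 mulr1 derivn0 mul1r.
rewrite derivSn derivM deriv_exp derivXsubC mul1r/=.
have -> : q^`() * ('X - zeta%:P) ^+ l.+1 + q * (('X - zeta%:P) ^+ l *+ l.+1) =
   (q^`() * ('X - zeta%:P) + q *+ l.+1) * ('X - zeta%:P) ^+ l.
  by rewrite mulrDl exprS mulrA mulrnAr mulrnAl.
rewrite IH hornerD hornerM hornerXsubC subrr mulr0 add0r hornerMn factS.
by rewrite -[X in _ * X = _]mulr_natl natrM mulrCA mulrA.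
Qed.

Lemma ntlim_unique (R : realType) (f : R[i] -> R[i]) zeta w w' :
  cabs zeta = 1 -> ntlim f zeta w -> ntlim f zeta w' -> w = w'.
Proof.
move=> zeta1 fw fw'; have M1 : 1 < 2 :> R by rewrite ltr1n.
have PF := ntfilter_proper M1 zeta1.
have h := @norm_hausdorff _ R[i].
by rewrite -(cvg_lim h (fw _ M1)) -(cvg_lim h (fw' _ M1)).
Qed.

Lemma ntlim_H2 (R : realType) (zeta : R[i]) (A q : {poly R[i]}) g (s : R) :
  cabs zeta = 1 -> H2_norm g s -> 'X - zeta%:P %| A ->
  ntlim (fun z => A.[z] * g z + q.[z]) zeta q.[zeta].
Proof.
move=> zeta1 /H2_norm_series[c [cg c0 _]] dA M M1.
have h := ntlim_vanishing zeta1 c0 cg (dA : ('X - zeta%:P) ^+ 1 %| A).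
have := cvgD (h M M1) (@ntlim_horner _ zeta q M M1).
by rewrite add0r; apply.
Qed.

(** Once [pf] is known to be divisible by (X - zeta)^l, this power cancels and f o phi = (U + qf) /
    V with U tending to 0 and V to q(zeta), which is nonzero. *)
Lemma ntlim_comp_poly (R : realType) (zeta : R[i]) (m l : nat)
    (a p q f pf : {poly R[i]}) (u phi g gf : R[i] -> R[i]) (s sf : R) :
  cabs zeta = 1 -> ('X - zeta%:P) ^+ m %| a -> (l < m)%N ->
  H2_norm g s -> H2_norm gf sf ->
  p = q * ('X - zeta%:P) ^+ l -> q.[zeta] != 0 ->
  (forall z, disk z -> disk (phi z)) ->
  (forall z, disk z -> u z = a.[z] * g z + p.[z]) ->
  (forall z, disk z -> u z * f.[phi z] = a.[z] * gf z + pf.[z]) ->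
  ntlim (fun z => f.[phi z]) zeta (pf^`(l).[zeta] / p^`(l).[zeta]).
Proof.
move=> zeta1 /dvdpP[b ab] lm Hg Hgf pq q0 phid uE ufE.
(* As l < m, the cofactor [A] still vanishes at zeta. *)
have [A aA dA] : exists2 A : {poly R[i]},
    a = A * ('X - zeta%:P) ^+ l & 'X - zeta%:P %| A.
  exists (b * ('X - zeta%:P) ^+ (m - l)).
    by rewrite ab -mulrA -exprD subnK// ltnW.
  by rewrite dvdp_mull// dvdp_exp// subn_gt0.
have zz z : disk z -> z - zeta != 0.
  move=> /diskE z1; rewrite subr_eq0; apply/eqP => zE.
  by move: z1; rewrite zE zeta1 ltxx.
pose V (z : R[i]) : R[i] := A.[z] * g z + q.[z].
pose U (z : R[i]) : R[i] := A.[z] * gf z + (0 : {poly R[i]}).[z].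
have VL : ntlim V zeta q.[zeta] := ntlim_H2 zeta1 Hg dA.
have UL : ntlim U zeta 0.
  by have := ntlim_H2 (q := 0) zeta1 Hgf dA; rewrite horner0; apply.
have VfE z : disk z -> (z - zeta) ^+ l * (V z * f.[phi z] - U z) = pf.[z].
  move=> dz; have := ufE z dz; rewrite uE// pq aA !hornerM !horner_exp.
  rewrite !hornerXsubC /V /U horner0 => h.
  apply: (addrI (A.[z] * (z - zeta) ^+ l * gf z)).
  by rewrite -h; ring.
have [B _ fB] := poly_bounded_disk f.
(* If the order j of [pf] at zeta were below l, dividing by (z - zeta)^j would give r = (z -
   zeta)^(l-j) (V (f o phi) - U), which tends to 0 since f o phi is bounded; but r(zeta) is
   nonzero. *)
have [qf pfE] : exists qf, pf = qf * ('X - zeta%:P) ^+ l.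
  have [->|pf0] := eqVneq pf 0; first by exists 0; rewrite mul0r.
  have [j [r rroot pfr]] := multiplicity_XsubC pf zeta.
  move: rroot; rewrite pf0/= => rroot.
  have [lj|jl] := leqP l j.
    by exists (r * ('X - zeta%:P) ^+ (j - l)); rewrite -mulrA -exprD subnK.
  case/negP: rroot; apply/eqP.
  apply: (ntlim_unique zeta1 (@ntlim_horner _ zeta r)) => M M1.
  pose d : {poly R[i]} := ('X - zeta%:P) ^+ (l - j).
  have d0 : d.[zeta] = 0.
    by rewrite horner_exp hornerXsubC subrr expr0n subn_eq0 leqNgt jl.
  have dL : horner d @ ntfilter M zeta --> (0 : R[i]).
    by rewrite -d0; exact: ntlim_horner.
  have dVL : (fun z : R[i] => d.[z] * V z) @ ntfilter M zeta --> (0 : R[i]).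
    by have := cvgM dL (VL M M1); rewrite mul0r; apply.
  have fBn : \forall z \near ntfilter M zeta, cabs f.[phi z] <= B.
    by apply: filterS (ntfilter_disk M zeta) => z /phid/fB.
  have dVfL : (fun z : R[i] => d.[z] * V z * f.[phi z]) @ ntfilter M zeta -->
      (0 : R[i]).
    exact: cvg_mul_bounded dVL fBn.
  have dUL : (fun z : R[i] => d.[z] * U z) @ ntfilter M zeta --> (0 : R[i]).
    by have := cvgM dL (UL M M1); rewrite mul0r; apply.
  have dL0 : (fun z : R[i] => d.[z] * V z * f.[phi z] - d.[z] * U z)
      @ ntfilter M zeta --> (0 : R[i]).
    by have := cvgB dVfL dUL; rewrite subr0; apply.
  apply: cvg_near_eq dL0 _.
  apply: filterS (ntfilter_disk M zeta) => z dz.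
  apply: (mulIf (expf_neq0 j (zz z dz))).
  have -> : r.[z] * (z - zeta) ^+ j = pf.[z].
    by rewrite pfr hornerM horner_exp hornerXsubC.
  rewrite -VfE// -(subnK (ltnW jl)) exprD /d horner_exp hornerXsubC.
  by ring.
(* The factors l! cancel. *)
have -> : pf^`(l).[zeta] / p^`(l).[zeta] = qf.[zeta] / q.[zeta].
  by rewrite pfE pq !derivn_XsubC_mul -mulf_div divff ?mul1r//.
move=> M M1.
have quoL : (fun z : R[i] => (U z + qf.[z]) * (V z)^-1) @ ntfilter M zeta -->
    qf.[zeta] / q.[zeta].
  have := cvgM (cvgD (UL M M1) (@ntlim_horner _ zeta qf M M1))
    (cvgV q0 (VL M M1)).
  by rewrite add0r; apply.
apply: cvg_near_eq quoL _.
have c0 : 0 < cabs q.[zeta] by rewrite lt_neqAle eq_sym cabs_eq0 q0 cabs_ge0.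
(* Closer to q(zeta) than |q(zeta)|, the function V has no zero. *)
have /cvg_cabsP/(_ _ c0) Vc := VL M M1.
apply: filterS (filterI (ntfilter_disk M zeta) Vc) => z [dz hV].
have V0 : V z != 0.
  by apply/eqP => Vz; move: hV; rewrite Vz subr0 ltxx.
apply: (mulIf V0); rewrite mulfVK//.
apply: (mulfI (expf_neq0 l (zz z dz))).
have := VfE z dz; rewrite pfE hornerM horner_exp hornerXsubC => h.
by rewrite mulrDr [_ * qf.[z]]mulrC -h; ring.
Qed.

(** * Polynomials in H(b) *)

Lemma size_bdry_poly (R : realType) n (zeta : 'I_n -> R[i]) (m : 'I_n -> nat) :
  size (bdry_poly zeta m) = (\sum_(i < n) m i).+1.
Proof.
rewrite /bdry_poly size_prod => [|i _].
  2: by rewrite expf_neq0// polyXsubC_eq0.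
under eq_bigr do rewrite size_exp_XsubC -addn1.
by rewrite big_split/= sum1_card -addSn addnK.
Qed.

Lemma H2_norm_ge0 (R : realType) (g : R[i] -> R[i]) (s : R) :
  H2_norm g s -> 0 <= s.
Proof. by case=> c []. Qed.

(** Euclidean division by a: the quotient is the H^2 part, and the remainder has degree below N. *)
Lemma Hb_norm_poly (R : realType) n (zeta : 'I_n -> R[i]) (m : 'I_n -> nat)
    (f : {poly R[i]}) :
  exists s, Hb_norm zeta m (horner f) s.
Proof.
pose a := bdry_poly zeta m.
exists (Num.sqrt (
  Num.sqrt (\sum_(i < size (f %/ a)) cabs (f %/ a)`_i ^+ 2) ^+ 2 +
  Num.sqrt (\sum_(i < size (f %% a)) cabs (f %% a)`_i ^+ 2) ^+ 2)).
exists (horner (f %/ a)), (f %% a); do 2!eexists; split=> //.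
- exact: poly_H2_norm.
- split; last exact: poly_H2_norm.
  rewrite -ltnS -(size_bdry_poly zeta m) ltn_modp -size_poly_eq0.
  by rewrite size_bdry_poly.
- move=> z _; rewrite [in LHS](divp_eq f a) hornerD hornerM mulrC.
  by [].
Qed.

(** A partial sum of the Cauchy kernel at w. Its n^2 unimodular coefficients give norm n without a
    root, while its value at w is n^2. *)
Lemma H2_norm_geometric (R : realType) (w : R[i]) n : cabs w = 1 ->
  exists2 s : R, s <= n%:R &
    H2_norm (horner (\poly_(k < n ^ 2) (w^-1) ^+ k)) s.
Proof.
move=> w1; set p := \poly_(k < _) _.
exists (Num.sqrt (\sum_(i < size p) cabs p`_i ^+ 2)); last exact: poly_H2_norm.
rewrite -[leRHS]ger0_norm// -sqrtr_sqr ler_sqrt ?sqr_ge0//.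
rewrite -natrX (@le_trans _ _ (\sum_(i < size p) 1))//.
  apply: ler_sum => i _; rewrite coef_poly; case: ifP => _.
    by rewrite cabsX cabsV w1 invr1 !expr1n.
  by rewrite cabs0 expr0n.
by rewrite sumr_const card_ord ler_nat size_poly.
Qed.

Lemma geometric_horner (R : realType) (w : R[i]) n : w != 0 ->
  (\poly_(k < n) (w^-1) ^+ k).[w] = n%:R.
Proof.
move=> w0; rewrite horner_poly.
under eq_bigr do rewrite -exprMn mulVf// expr1n.
by rewrite sumr_const card_ord.
Qed.

(** Of the norm of W f only the polynomial component is kept, being at most the whole; [|M|]
    supplies a nonnegative constant. *)
Lemma wcomp_poly_Hb (R : realType) n (zeta : 'I_n -> R[i]) (m : 'I_n -> nat)
    (u phi : R[i] -> R[i]) :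
  bounded_on_Hb zeta m (wcomp u phi) ->
  exists2 M : R, 0 <= M & forall (f : {poly R[i]}) (s : R),
    Hb_norm zeta m (horner f) s ->
    exists (g : R[i] -> R[i]) (p : {poly R[i]}) (sg sp : R),
      [/\ H2_norm g sg, (size p <= \sum_(i < n) m i)%N,
          H2_norm (horner p) sp, sp <= M * s &
          forall z, disk z ->
            u z * f.[phi z] = (bdry_poly zeta m).[z] * g z + p.[z]].
Proof.
move=> [M WM]; exists `|M| => // f s fs.
have s0 : 0 <= s by case: fs => ? [? [? [? [_ _ _ ->]]]]; exact: sqrtr_ge0.
have [t [[g [p [sg [sp [gsg [pN psp] E ->]]]]] tM]] := WM _ _ fs.
exists g, p, sg, sp; split=> //.
have sp0 := H2_norm_ge0 psp.
apply: (@le_trans _ _ (M * s)); last by rewrite ler_wpM2r// ler_norm.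
rewrite (le_trans _ tM)// -[leLHS]ger0_norm// -sqrtr_sqr.
by rewrite ler_sqrt ?addr_ge0 ?sqr_ge0// lerDr sqr_ge0.
Qed.

Lemma cabs_norm1 (R : realType) (z : R[i]) : `|z| = 1 -> cabs z = 1.
Proof. by move=> z1; apply: complexI; rewrite rmorph1. Qed.

(** If a(w) were nonzero, the product of a and the kernel sum with k^2 terms would have norm at most
    k but modulus |a(w)| k^2 at w. *)
Lemma bounded_eval_bdry_root (R : realType) n (zeta : 'I_n -> R[i])
    (m : 'I_n -> nat) (w : R[i]) (C : R) :
  cabs w = 1 ->
  (forall (f : {poly R[i]}) (s : R), Hb_norm zeta m (horner f) s ->
     cabs f.[w] <= C * s) ->
  exists j, w = zeta j.
Proof.
move=> w1 fC; apply: contrapT => wz.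
have w0 : w != 0 by rewrite -cabs_eq0 w1 oner_eq0.
have aw : (bdry_poly zeta m).[w] != 0.
  rewrite horner_prod; apply/prodf_neq0 => j _.
  rewrite horner_exp hornerXsubC expf_neq0// subr_eq0.
  by apply/eqP => wj; apply: wz; exists j.
have A0 : 0 < cabs (bdry_poly zeta m).[w].
  by rewrite lt_neqAle eq_sym cabs_eq0 aw cabs_ge0.
set A := cabs _ in A0.
have key k : A * k%:R ^+ 2 <= `|C| * k%:R.
  have [s sk gs] := H2_norm_geometric k w1; have s0 := H2_norm_ge0 gs.
  set g := \poly_(_ < _) _ in gs.
  have H0 : H2_norm (horner (0 : {poly R[i]})) 0.
    have := poly_H2_norm (0 : {poly R[i]}).
    by rewrite size_poly0 big_ord0 sqrtr0.
  have := fC (bdry_poly zeta m * g) s; rewrite hornerM geometric_horner//.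
  rewrite cabsM cabs_nat natrX => /(_ _)/le_trans -> //.
    exists (horner g), 0, s, 0; split=> //.
    - by rewrite size_poly0.
    - by move=> z _; rewrite horner0 addr0 hornerM.
    - by rewrite expr0n addr0 sqrtr_sqr ger0_norm.
  by rewrite (le_trans (ler_wpM2r s0 (ler_norm C)))// ler_wpM2l.
(* An integer above |C| / A, which contradicts [key]. *)
pose k := (Num.truncn (`|C| / A)).+1.
have kC : `|C| / A < k%:R by rewrite /k; exact: truncnS_gt.
have k0 : (0 : R) < k%:R by rewrite ltr0n.
have := key k; rewrite expr2 mulrA ler_pM2r// leNgt.
by move: kC; rewrite ltr_pdivrMr// mulrC => ->.
Qed.

(** * Vanishing of u at zeta_i, or a boundary limit of phi *)

Unset Implicit Arguments.

Theorem theorem4p1 (R : realType)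
  (* b = pb / qb *)
  (pb qb : {poly R[i]})
  (b_reduced : coprimep pb qb)
  (b_analytic : forall z, disk z -> qb.[z] != 0)
  (b_norm : Hinfty_norm (ratfun pb qb) = 1%:E)
  (b_not_Blaschke : ~ finite_Blaschke (ratfun pb qb))
  (* its Pythagorean mate pa / qa *)
  (pa qa : {poly R[i]})
  (a_reduced : coprimep pa qa)
  (a_poles : forall z : R[i], `|z| <= 1 -> qa.[z] != 0)
  (a_mate : pythagorean_mate (ratfun pb qb) (ratfun pa qa))
  (* the distinct zeros of the mate on the circle, with multiplicities *)
  (n : nat) (zeta : 'I_n -> R[i]) (m : 'I_n -> nat)
  (zeta_inj : injective zeta)
  (zetaP : forall z : R[i], (exists i, z = zeta i) <->
                     `|z| = 1 /\ ratfun pa qa z = 0)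
  (mP : forall i, m i = mup (zeta i) pa)
  (u phi : R[i] -> R[i])
  (u_analytic : analytic_disk u)
  (phi_analytic : analytic_disk phi)
  (phi_disk : forall z, disk z -> disk (phi z))
  (W_bounded : bounded_on_Hb zeta m (wcomp u phi)) :
  forall i : 'I_n,
    (forall l, (l < m i)%N -> ntlim (derive1n l u) (zeta i) 0)
    \/
    (exists l, (l < m i)%N /\
       exists v, v <> 0 /\ ntlim (derive1n l u) (zeta i) v)
    /\
    (exists w, ntlim phi (zeta i) w /\ (`|w| < 1 \/ exists j, w = zeta j)).
Proof.
move=> i.
have zeta1 : cabs (zeta i) = 1.
  have /(proj1 (zetaP _)) [/cabs_norm1] : exists j, zeta i = zeta j by exists i.
  exact.
have am : ('X - (zeta i)%:P) ^+ m i %| bdry_poly zeta m.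
  by rewrite /bdry_poly (bigD1 i)//= dvdp_mulr.
have [M M0 WM] := wcomp_poly_Hb W_bounded.
(* The constant 1 is mapped to u, which yields the decomposition u = a g + p. *)
have [s1 Hs1] := Hb_norm_poly zeta m 1.
have [g [p [sg [sp [gsg _ _ _ uE1]]]]] := WM _ _ Hs1.
have uE z : disk z -> u z = (bdry_poly zeta m).[z] * g z + p.[z].
  by move=> /uE1 <-; rewrite hornerC mulr1.
have uL l : (l < m i)%N -> ntlim (derive1n l u) (zeta i) p^`(l).[zeta i].
  by move=> lm; exact: ntlim_derive1n zeta1 gsg lm am uE.
have [l [q qroot pq]] := multiplicity_XsubC p (zeta i).
(* If p vanishes at zeta_i to order at least m_i, all limits of derivatives up to order m_i - 1 are
   0; otherwise l, the order of p there, is the index sought. *)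
have [small|/norP[p0]] := boolP ((p == 0) || (m i <= l)%N).
  left=> j jm; have -> : 0 = p^`(j).[zeta i]; last exact: uL.
  case/orP: small => [/eqP ->|ml]; first by rewrite linear0 horner0.
  rewrite pq -(subnK (ltnW (leq_trans jm ml))) exprD mulrA derivn_XsubC_mul.
  rewrite hornerM horner_exp hornerXsubC subrr expr0n subn_eq0 leqNgt.
  by rewrite (leq_trans jm ml) !mulr0.
rewrite -ltnNge => lm; right.
have q0 : q.[zeta i] != 0 by move: qroot; rewrite p0.
have pl0 : p^`(l).[zeta i] != 0.
  by rewrite pq derivn_XsubC_mul mulf_neq0// pnatr_eq0 -lt0n fact_gt0.
split.
  by exists l; split=> //; exists p^`(l).[zeta i]; split; [exact/eqP|exact: uL].
have [C C0 LC] := poly_linear_functional_bound (\sum_(i < n) m i)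
  (horner_eval (zeta i) \o derivn l).
(* The limit of f o phi exists and is controlled by the norm of f, through the l-th derivative of
   the polynomial part of W f. *)
have comp f s : Hb_norm zeta m (horner f) s -> exists2 v,
    ntlim (fun z => f.[phi z]) (zeta i) v &
    cabs v <= C * M / cabs p^`(l).[zeta i] * s.
  move=> /WM[gf [pf [sgf [spf [Hgf pfN Hpf spfM fE]]]]].
  exists (pf^`(l).[zeta i] / p^`(l).[zeta i]).
    exact: ntlim_comp_poly zeta1 am lm gsg Hgf pq q0 phi_disk uE fE.
  rewrite cabsM cabsV [leRHS]mulrAC ler_wpM2r ?invr_ge0 ?cabs_ge0//.
  by rewrite (le_trans (LC _ _ pfN Hpf))// -mulrA ler_wpM2l.
(* Taking f = X gives the limit of phi itself. *)
have [sX HX] := Hb_norm_poly zeta m 'X.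
have [w wL' _] := comp _ _ HX.
have wL : ntlim phi (zeta i) w.
  by apply: ntlim_eq_disk wL' => z _; rewrite hornerX.
exists w; split=> //.
have w1 : cabs w <= 1.
  have M1 : 1 < 2 :> R by rewrite ltr1n.
  have PF := ntfilter_proper M1 zeta1.
  apply: (cabs_lim_le (wL _ M1)).
  by apply: filterS (ntfilter_disk 2 (zeta i)) => z /phi_disk/diskE/ltW.
have [w1'|w1'] := ltP (cabs w) 1; first by left; apply/diskE.
right; apply: (@bounded_eval_bdry_root R n zeta m w
  (C * M / cabs p^`(l).[zeta i])); first by apply/eqP; rewrite eq_le w1.
(* By continuity f o phi also tends to f(w), so [v] is f(w) and evaluation at w is bounded. *)
move=> f s /comp[v vL]; congr (cabs _ <= _).
apply: (ntlim_unique zeta1 vL) => N N1; apply: cvg_horner; exact: wL.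
Qed.
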